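(* Let $G$ be a graph on $n$ nodes with adjacency matrix $A$, $G\neq K_n$ and $G\neq\overline{K_n}$. Let $\mu_{\min}$ and $\mu_{\max}$ be the minimum and maximum eigenvalues of $V^TAV$, let $m(\mu_{\min})$ be the multiplicity of $\mu_{\min}$, and let $Z_u=VU_u$. If $G$ is a complete multipartite graph, i.e., if $\mu_{\max}=0$, then \[ \dim_S(G)=\begin{cases} n-1-m(\mu_{\min}) & \text{if } AZ_u=\mu_{\min}Z_u,\\ n-1 & \text{otherwise.}\end{cases} \]
   Context: Graphs are simple. $e$ is the all-ones vector in $\mathbb{R}^n$. $V$ is an $n\times(n-1)$ matrix whose columns form an orthonormal basis of $e^\perp$, i.e. $V^Te=0$ and $V^TV=I_{n-1}$. $U_u$ is an $(n-1)\times m(\mu_{\min})$ matrix whose columns form an orthonormal basis of the eigenspace of $V^TAV$ associated with $\mu_{\min}$. A Euclidean representation of $G$ in $\mathbb{R}^r$ is a configuration of points $p^1,\ldots,p^n\in\mathbb{R}^r$ for which there are two distinct positive scalars $\alpha\neq\beta$ such that for all $i\neq j$, $\|p^i-p^j\|^2=\alpha$ if $\{i,j\}$ is an edge of $G$, and $\|p^i-p^j\|^2=\beta$ otherwise. It is a spherical representation in $\mathbb{R}^r$ if the points lie on an $(r-1)$-sphere in $\mathbb{R}^r$ (of any radius and center). $\dim_S(G)$ is the smallest $r$ for which $G$ admits a spherical representation in $\mathbb{R}^r$. A complete multipartite graph is the complement of a disjoint union of complete graphs (an isolated node $K_1$ counts as complete); equivalently, its nodes can be partitioned into independent sets such that any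 two nodes in different sets are adjacent. For $G\neq K_n$, being complete multipartite is equivalent to $\mu_{\max}=0$. $\overline{K_n}$ is the null graph (no edges). *)

(* Defs.v *)
From mathcomp Require Import all_boot all_order all_algebra.
From mathcomp Require Import reals.
Set Implicit Arguments.
Unset Strict Implicit.
Unset Printing Implicit Defensive.
Import Order.TTheory GRing.Theory Num.Theory.
Local Open Scope ring_scope.

Definition simple_graph n (G : rel 'I_n) : Prop := symmetric G /\ irreflexive G.

Definition complete_graph n : rel 'I_n := fun i j => i != j.

Definition null_graph n : rel 'I_n := fun _ _ => false.

Definition complete_multipartite n (G : rel 'I_n) : Prop :=
  exists P : {set {set 'I_n}},
    [/\ partition P [set: 'I_n],
        forall B i j, B \in P -> i \in B -> j \in B -> ~~ G i j
      & forall B C i j, B \in P -> C \in P -> B != C ->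
          i \in B -> j \in C -> G i j].

Section Euclidean.
Variable R : realType.

(* The norm `|_| of row vectors in the library is the sup norm, so the
   Euclidean distance is written out. *)
Definition sqdist r (x y : 'rV[R]_r) : R := \sum_k (x 0 k - y 0 k) ^+ 2.

Definition euclidean_representation n (G : rel 'I_n) r
    (p : 'I_n -> 'rV[R]_r) : Prop :=
  exists alpha beta : R,
    [/\ 0 < alpha, 0 < beta, alpha != beta
      & forall i j, i != j ->
          sqdist (p i) (p j) = if G i j then alpha else beta].

Definition on_sphere n r (p : 'I_n -> 'rV[R]_r) : Prop :=
  exists (c : 'rV[R]_r) (rho : R),
    0 < rho /\ forall i, sqdist (p i) c = rho ^+ 2.

Definition has_spherical_representation n (G : rel 'I_n) (r : nat) : Prop :=
  exists p : 'I_n -> 'rV[R]_r, euclidean_representation G p /\ on_sphere p.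

(* [is_dimS G r] reads dim_S(G) = r. *)
Definition is_dimS n (G : rel 'I_n) (r : nat) : Prop :=
  has_spherical_representation G r /\
  forall s : nat, has_spherical_representation G s -> (r <= s)%N.

End Euclidean.

Section Spectral.
Variable R : realType.

Definition adjmx n (G : rel 'I_n) : 'M[R]_n := \matrix_(i, j) (G i j)%:R.

Definition ones n : 'cV[R]_n := const_mx 1.

Definition orthonormal_cols m k (W : 'M[R]_(m, k)) : Prop :=
  W^T *m W = 1%:M.

(* As V has n - 1 columns, these form an orthonormal basis of the orthogonal
   complement of the all-ones vector. *)
Definition ones_perp_basis n (V : 'M[R]_(n, n.-1)) : Prop :=
  V^T *m ones n = 0 /\ orthonormal_cols V.

Definition min_eigenvalue k (M : 'M[R]_k) (a : R) : Prop :=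
  eigenvalue M a /\ forall b, eigenvalue M b -> a <= b.

Definition max_eigenvalue k (M : 'M[R]_k) (a : R) : Prop :=
  eigenvalue M a /\ forall b, eigenvalue M b -> b <= a.

(* Dimension of the eigenspace; only used for symmetric matrices, for which it
   is also the algebraic multiplicity. *)
Definition multiplicity k (M : 'M[R]_k) (a : R) : nat := \rank (eigenspace M a).

(* [eigenspace] is a space of row vectors v with v *m M = a *: v, whence the
   two transpositions: column vectors u with M *m u = a *: u are meant. *)
Definition orthonormal_eigenbasis k m (M : 'M[R]_k) (a : R)
    (W : 'M[R]_(k, m)) : Prop :=
  orthonormal_cols W /\ (W^T :=: eigenspace M^T a)%MS.

End Spectral.

(* Main.v *)
Require Import Defs.
From mathcomp Require Import all_boot all_order all_algebra.
From mathcomp Require Import reals.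
From mathcomp Require Import complex.
From mathcomp Require Import ring lra zify.
Set Implicit Arguments.
Unset Strict Implicit.
Unset Printing Implicit Defensive.
Import Order.TTheory GRing.Theory Num.Theory.
Local Open Scope ring_scope.

(** Let [M = V^T A V], and let [e] be the all-ones vector.

    A spherical representation, once its sphere is centred at the origin, is a
    factorization [Q *m Q^T = B + const_mx gamma] of an affine function
    [B = beta / 2 + (beta - alpha) / 2 *: A] of the adjacency matrix, up to a
    constant ([spherical_representationP]).  Compressing by [V] removes the
    constant and leaves [N = beta / 2 + (beta - alpha) / 2 *: M], which must be
    positive semidefinite of rank at most the dimension.  In the other direction,
    a positive semidefinite [N] yields a representation in dimension [\rank N] as
    soon as the vector [e^T B V] lies in the row space of [N]; this is the
    condition for the points to lie on a sphere ([spherical_of_compression]).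

    The signs of the spectrum of [M] then decide everything.  If [G] is complete
    multipartite, the form of [A] on the orthogonal complement of [e] is minus a
    sum of squares of sums over the parts, so [M] is negative semidefinite; and
    two vertices of one part give a kernel vector, so the maximal eigenvalue is
    0.  Conversely, a vector with entries 1, 1, -2 shows that a negative
    semidefinite [M] forces non-adjacency to be transitive.

    For negative semidefinite [M], the matrix [N] can be both positive
    semidefinite and singular only if [alpha < beta] and
    [beta + (beta - alpha) * mumin = 0], that is, if [N] is a positive multiple of
    [M - mumin%:M], of rank [n - 1 - m]; otherwise the dimension is at least
    [n - 1].  In the singular case the kernel of [N] must annihilate the points,
    which amounts to [A Z = mumin Z] ([spherical_dim_bound]).  The values
    [alpha = - mumin - 1] and [beta = - mumin] attain the singular case when the
    equation holds; [alpha] is positive because two non-adjacent vertices and a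
    common neighbour push the Rayleigh quotient below -1
    ([multipartite_min_eigenvalue], [spherical_reduced_dim]).  Dimension [n - 1]
    is always attained by a simplex ([spherical_full_dim]). *)

(** * Quadratic forms of real symmetric matrices *)

Definition qform (R : pzRingType) n (M : 'M[R]_n) (x : 'rV[R]_n) : R :=
  (x *m M *m x^T) 0 0.

Definition sqnorm (R : pzRingType) n (x : 'rV[R]_n) : R := (x *m x^T) 0 0.

Definition psd (R : numDomainType) n (M : 'M[R]_n) : Prop :=
  forall x, 0 <= qform M x.

Section QuadraticForms.
Context {R : realFieldType}.
Implicit Types (a b : R).

Lemma sqnormE n (x : 'rV[R]_n) : sqnorm x = \sum_k x 0 k ^+ 2.
Proof. by rewrite /sqnorm mxE; apply: eq_bigr => k _; rewrite mxE expr2. Qed.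

Lemma sqnorm_ge0 n (x : 'rV[R]_n) : 0 <= sqnorm x.
Proof. by rewrite sqnormE; apply: sumr_ge0 => k _; apply: sqr_ge0. Qed.

Lemma sqnorm_eq0 n (x : 'rV[R]_n) : (sqnorm x == 0) = (x == 0).
Proof.
apply/eqP/eqP => [|->]; last by rewrite /sqnorm mul0mx mxE.
rewrite sqnormE => /psumr_eq0P x0; apply/rowP => k; rewrite mxE.
by apply/eqP; rewrite -sqrf_eq0 x0 // => i _; apply: sqr_ge0.
Qed.

Lemma qform_gram n k (W : 'M[R]_(n, k)) x :
  qform (W *m W^T) x = sqnorm (x *m W).
Proof. by rewrite /qform /sqnorm trmx_mul !mulmxA. Qed.

Lemma qform_affine n (M : 'M[R]_n) a b x :
  qform (a%:M + b *: M) x = a * sqnorm x + b * qform M x.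
Proof.
rewrite /qform /sqnorm mulmxDr mulmxDl mul_mx_scalar -scalemxAr -!scalemxAl.
by rewrite mxE; congr (_ + _); rewrite mxE.
Qed.

Lemma qformZ n (M : 'M[R]_n) a x : qform M (a *: x) = a ^+ 2 * qform M x.
Proof.
by rewrite /qform linearZ /= -!scalemxAl -scalemxAr scalerA mxE -expr2.
Qed.

Lemma polar_sym n (M : 'M[R]_n) (x y : 'rV[R]_n) : M^T = M ->
  (x *m M *m y^T) 0 0 = (y *m M *m x^T) 0 0.
Proof.
move=> MT; transitivity ((x *m M *m y^T)^T 0 0); first by rewrite [RHS]mxE.
by rewrite !trmx_mul trmxK MT mulmxA.
Qed.

Lemma qformD n (M : 'M[R]_n) x y : M^T = M ->
  qform M (x + y) = qform M x + qform M y + 2 * (x *m M *m y^T) 0 0.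
Proof.
move=> MT.
have E : (y *m M *m x^T) 0 0 = (x *m M *m y^T) 0 0 by exact: polar_sym.
rewrite {1}/qform linearD /= !mulmxDl !mulmxDr mxE.
rewrite [X in X + _]mxE [X in _ + X]mxE E /qform; ring.
Qed.

Lemma delta_polar n (M : 'M[R]_n) i j :
  ((delta_mx 0 i : 'rV_n) *m M *m (delta_mx 0 j : 'rV_n)^T) 0 0 = M i j.
Proof. by rewrite -rowE trmx_delta -colE !mxE. Qed.

(** A symmetric matrix is determined by its quadratic form: if the form vanishes
    at every basis vector, an entry [M i j] is half its value at the sum of the
    [i]-th and [j]-th basis vectors. *)
Lemma psd_neq0 n (M : 'M[R]_n) : M^T = M -> psd M -> M != 0 ->
  exists x, 0 < qform M x.
Proof.
move=> MT Mpsd M0.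
have pos x : qform M x != 0 -> exists y, 0 < qform M y.
  by exists x; rewrite lt_neqAle eq_sym Mpsd andbT.
have [/existsP[i Mii]|/existsPn diag0] := boolP [exists i, M i i != 0].
  by apply: (pos (delta_mx 0 i)); rewrite /qform delta_polar.
have {}diag0 i : M i i = 0 by have /negPn/eqP := diag0 i.
have /existsP[i /existsP[j Mij]] : [exists i, exists j, M i j != 0].
  apply: contraR M0 => /existsPn H; apply/eqP/matrixP => i j; rewrite mxE.
  by have /existsPn/(_ j)/negPn/eqP := H i.
apply: (pos (delta_mx 0 i + delta_mx 0 j)).
rewrite qformD // /qform !delta_polar !diag0 !add0r mulf_neq0 //.
by rewrite pnatr_eq0.
Qed.

End QuadraticForms.

(** A Cholesky factorization whose width is the rank.  Normalize a vector [x] so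
    that the form is 1 at [x], and let [v = x *m M].  Subtracting [v^T *m v]
    leaves a positive semidefinite matrix, because its form at [y] is that of [M]
    at the component of [y] that is [M]-orthogonal to [x]; and [x] becomes a new
    kernel vector, so the rank drops and induction applies. *)
Lemma psd_factor (R : rcfType) n r (M : 'M[R]_n) : M^T = M -> psd M ->
  (\rank M <= r)%N -> exists W : 'M[R]_(n, r), M = W *m W^T.
Proof.
elim: r M => [|r IHr] M MT Mpsd rkM.
  exists 0; rewrite mul0mx; apply/eqP; rewrite -mxrank_eq0.
  by rewrite leqn0 in rkM.
have [->|M0] := eqVneq M 0; first by exists 0; rewrite mul0mx.
have [x0 x0pos] := psd_neq0 MT Mpsd M0.
pose x := (Num.sqrt (qform M x0))^-1 *: x0.
have x1 : qform M x = 1.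
  by rewrite qformZ exprVn sqr_sqrtr ?ltW // mulVf // gt_eqF.
pose v := x *m M.
have vT : v^T = M *m x^T by rewrite trmx_mul MT.
have xv : x *m v^T = 1%:M.
  by rewrite vT mulmxA [LHS]mx11_scalar -[X in X%:M]/(qform M x) x1.
pose M' := M - v^T *m v.
have M'T : M'^T = M' by rewrite linearB /= trmx_mul trmxK MT.
have M'psd : psd M'.
  move=> y; pose t := (y *m v^T) 0 0.
  suff -> : qform M' y = qform M (y + (- t) *: x) by apply: Mpsd.
  have yv : y *m v^T = t%:M by exact: mx11_scalar.
  rewrite qformD // qformZ x1 linearZ /= -scalemxAr -mulmxA -vT yv.
  rewrite /qform mulmxBr mulmxBl mulmxA yv mul_scalar_mx -scalemxAl.
  have -> : v *m y^T = t%:M by rewrite -(tr_scalar_mx _ t) -yv trmx_mul trmxK.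
  by rewrite mxE !mxE !mulr1n; ring.
have rkM' : (\rank M' <= r)%N.
  (* x is a new kernel vector *)
  have sub : (kermx M + x <= kermx M')%MS.
    rewrite addsmx_sub; apply/andP; split; apply/sub_kermxP.
      by rewrite mulmxBr vT !mulmxA mulmx_ker !mul0mx subr0.
    by rewrite mulmxBr mulmxA xv mul1mx subrr.
  have x_notin : ~~ (x <= kermx M)%MS.
    apply/sub_kermxP => /(congr1 (fun z => z *m x^T)).
    rewrite mul0mx => /(congr1 (fun z : 'M_1 => z 0 0)).
    by rewrite -/(qform M x) x1 mxE => /eqP; rewrite oner_eq0.
  have : (kermx M < kermx M')%MS.
    rewrite /ltmx (submx_trans _ sub) ?addsmxSl //=.
    apply: contra x_notin; apply: submx_trans.
    by apply: submx_trans sub; apply: addsmxSr.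
  rewrite ltmxErank !mxrank_ker => /andP[_].
  by have := rank_leq_row M; have := rank_leq_row M'; lia.
have [W M'W] := IHr M' M'T M'psd rkM'.
pose X : 'M[R]_(n, 1 + r) := row_mx v^T W.
suff MX : M = X *m X^T by exists X.
rewrite tr_row_mx trmxK mul_row_col -M'W.
by rewrite addrC subrK.
Qed.

(** The spectral theorem over the complex numbers diagonalizes [M] in a unitary
    basis.  Its diagonal entries are real, hence eigenvalues of [M] itself, hence
    at least [a]; in that basis the inequality holds term by term. *)
Lemma rayleigh_lower_bound (R : rcfType) n (M : 'M[R]_n) a : M^T = M ->
  (forall b, eigenvalue M b -> a <= b) ->
  forall x, a * sqnorm x <= qform M x.
Proof.
move=> MT a_le x; pose f := real_complex R.
pose MC : 'M[R[i]]_n := map_mx f M.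
have fconj m k (B : 'M[R]_(m, k)) : map_mx Num.conj (map_mx f B) = map_mx f B.
  apply/matrixP => i j; rewrite !mxE; apply/CrealP/complex_realP.
  by exists (B i j).
have MCherm : MC \is hermsymmx.
  by apply/is_hermitianmxP; rewrite expr0 scale1r /MC map_trmx MT fconj.
have /orthomx_spectralP MCdiag := hermitian_normalmx MCherm.
have d_real := hermitian_spectral_diag_real MCherm.
set P := spectralmx MC in MCdiag; set d := spectral_diag MC in MCdiag d_real.
have Pu : P \in unitmx := spectral_unit MC.
have PK : invmx P = map_mx Num.conj P^T.
  exact: invmx_unitary (spectral_unitarymx MC).
have PMC : P *m MC = diag_mx d *m P.
  by rewrite [X in _ *m X]MCdiag !mulmxA mulmxV // mul1mx.
have d_ge j : f a <= d 0 j.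
  have /complex_realP[t dt] : d 0 j \is Num.real by move/mxOverP: d_real; apply.
  rewrite dt lecR; apply: a_le.
  rewrite -(eigenvalue_map f) -/MC; apply/eigenvalueP; exists (row j P).
    by rewrite -row_mul PMC row_mul row_diag_mx -scalemxAl -rowE dt.
  apply/eqP => r0; have := congr1 (row j) (mulmxV Pu).
  rewrite row_mul r0 mul0mx row1 => /matrixP/(_ 0 j).
  by rewrite !mxE !eqxx => /eqP; rewrite eq_sym oner_eq0.
pose y := map_mx f x *m invmx P.
have yT : P *m (map_mx f x)^T = map_mx Num.conj y^T.
  rewrite trmx_mul map_mxM PK -map_trmx /= trmxK -map_mx_comp.
  by rewrite (map_mx_id (@conjCK _)) map_trmx fconj.
have qE : f (qform M x) = \sum_j d 0 j * `|y 0 j| ^+ 2.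
  transitivity ((map_mx f x *m MC *m (map_mx f x)^T) 0 0).
    by rewrite map_trmx -!map_mxM mxE.
  rewrite MCdiag !mulmxA -/y -mulmxA yT mxE; apply: eq_bigr => j _.
  by rewrite mul_mx_diag !mxE normCK; ring.
have nE : f (sqnorm x) = \sum_j `|y 0 j| ^+ 2.
  transitivity ((map_mx f x *m (map_mx f x)^T) 0 0).
    by rewrite map_trmx -!map_mxM mxE.
  rewrite -[map_mx f x](mulmxKV Pu) -/y -mulmxA mulmxKV // yT mxE.
  by apply: eq_bigr => j _; rewrite !mxE normCK.
suff: f (a * sqnorm x) <= f (qform M x) by rewrite lecR.
have -> : f (a * sqnorm x) = f a * f (sqnorm x) by exact: rmorphM.
rewrite nE qE mulr_sumr; apply: ler_sum => j _.
by rewrite ler_wpM2r // exprn_ge0.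
Qed.

Lemma mulmx_gram_eq0 (R : realFieldType) m n k
    (X : 'M[R]_(m, n)) (Y : 'M[R]_(n, k)) :
  X *m (Y *m Y^T) = 0 -> X *m Y = 0.
Proof.
move=> XYY0; apply/row_matrixP => i; rewrite row0; apply/eqP.
rewrite -sqnorm_eq0 /sqnorm -row_mul.
rewrite !row_mul trmx_mul mulmxA -(mulmxA (row i X)) -row_mul XYY0.
by rewrite row0 mul0mx mxE.
Qed.

Lemma qform_delta3 (R : realFieldType) n (M : 'M[R]_n) i j k : M^T = M ->
  qform M (delta_mx 0 i + delta_mx 0 j + (- 2) *: delta_mx 0 k) =
    M i i + M j j + 4 * M k k + 2 * M i j - 4 * M i k - 4 * M j k.
Proof.
move=> MT; rewrite !qformD // qformZ linearZ /= -scalemxAr !mulmxDl.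
rewrite [X in _ + 2 * X]mxE [X in _ + 2 * (_ * X)]mxE /qform !delta_polar; ring.
Qed.

(** * Spherical representations as Gram factorizations *)

Section GramMatrices.
Context {R : realType}.

(** With the value 0 on the diagonal, the prescribed squared distances form the
    matrix [D = const_mx beta - 2 *: dist_gram G alpha beta]; so, by
    polarization, [dist_gram] is the Gram matrix of the points up to terms
    depending on one index only. *)
Definition dist_gram n (G : rel 'I_n) (alpha beta : R) : 'M[R]_n :=
  (beta / 2)%:M + ((beta - alpha) / 2) *: adjmx R G.

Lemma adjmx_sym n (G : rel 'I_n) : symmetric G -> (adjmx R G)^T = adjmx R G.
Proof. by move=> Gs; apply/matrixP => i j; rewrite !mxE Gs. Qed.

Lemma dist_gram_sym n (G : rel 'I_n) alpha beta :
  symmetric G -> (dist_gram G alpha beta)^T = dist_gram G alpha beta.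
Proof.
by move=> Gs; rewrite /dist_gram linearD linearZ /= tr_scalar_mx adjmx_sym.
Qed.

Lemma sqdistE r (x y : 'rV[R]_r) : sqdist x y = sqnorm (x - y).
Proof. by rewrite sqnormE; apply: eq_bigr => k _; rewrite !mxE. Qed.

Lemma sqnormB r (x y : 'rV[R]_r) :
  sqnorm (x - y) = sqnorm x + sqnorm y - 2 * (x *m y^T) 0 0.
Proof.
have := @qformD R r 1%:M x (- y) (trmx1 _ _).
rewrite /qform !mulmx1 -/(sqnorm (x - y)) -/(sqnorm x) => ->.
by rewrite linearN /= mulNmx !mulmxN opprK [X in 2 * X]mxE -/(sqnorm y); ring.
Qed.

Lemma gram_entry n r (Q : 'M[R]_(n, r)) i j :
  (row i Q *m (row j Q)^T) 0 0 = (Q *m Q^T) i j.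
Proof. by rewrite !mxE; apply: eq_bigr => k _; rewrite !mxE. Qed.

(** Put the origin at the centre of the sphere, of radius [rho]: the squared
    distance of two points is then [2 * rho ^+ 2] minus twice their inner
    product, so the Gram matrix is [dist_gram] shifted by the constant
    [rho ^+ 2 - beta / 2].  Two distinct indices exclude a sphere of radius 0. *)
Lemma spherical_representationP n (G : rel 'I_n) r (i0 j0 : 'I_n) :
  simple_graph G -> i0 != j0 ->
  has_spherical_representation R G r <->
  exists alpha beta gamma (Q : 'M[R]_(n, r)),
    [/\ 0 < alpha, 0 < beta, alpha != beta
      & Q *m Q^T = dist_gram G alpha beta + const_mx gamma].
Proof.
move=> [Gs Gi] ij0; split.
  move=> [p [[alpha [beta [a0 b0 ab dE]]] [c [rho [_ cE]]]]].
  pose Q := \matrix_i (p i - c).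
  exists alpha, beta, (rho ^+ 2 - beta / 2), Q; split=> //.
  apply/matrixP => i j; rewrite -gram_entry !rowK.
  have nE k : sqnorm (p k - c) = rho ^+ 2 by rewrite -sqdistE.
  have [<-|ij] := eqVneq i j.
    by rewrite -/(sqnorm _) nE !mxE eqxx Gi mulr1n mulr0 addr0 addrC subrK.
  have := dE _ _ ij.
  have -> : sqdist (p i) (p j) = sqnorm ((p i - c) - (p j - c)).
    by rewrite sqdistE opprB addrA subrK.
  rewrite sqnormB !nE !mxE (negPf ij) mulr0n.
  by case: (G i j) => /= H; lra.
move=> [alpha [beta [gamma [Q [a0 b0 ab QE]]]]].
have dE i j : i != j ->
    sqdist (row i Q) (row j Q) = if G i j then alpha else beta.
  move=> ij; rewrite sqdistE sqnormB {1 2}/sqnorm !gram_entry QE.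
  rewrite !mxE !Gi !eqxx (negPf ij) mulr1n mulr0n.
  by case: (G i j) => /=; lra.
have nE i : sqnorm (row i Q) = beta / 2 + gamma.
  by rewrite /sqnorm gram_entry QE !mxE Gi eqxx mulr1n mulr0 addr0.
exists (fun i => row i Q); split; first by exists alpha, beta.
exists 0, (Num.sqrt (beta / 2 + gamma)).
have t0 : 0 <= beta / 2 + gamma by rewrite -(nE i0) sqnorm_ge0.
split; last by move=> i; rewrite sqdistE subr0 nE sqr_sqrtr.
rewrite sqrtr_gt0 lt_neqAle t0 andbT; apply/eqP => tE.
have rE i : row i Q = 0 by apply/eqP; rewrite -sqnorm_eq0 nE -tE.
have := dE _ _ ij0; rewrite !rE sqdistE subrr.
have -> : sqnorm (0 : 'rV[R]_r) = 0 by apply/eqP; rewrite sqnorm_eq0.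
by case: (G i0 j0); lra.
Qed.

(** The rows of [V^T] span the orthogonal complement of the all-ones vector, on
    which [V *m V^T] acts as the identity. *)
Lemma proj_ones_perp n (V : 'M[R]_(n, n.-1)) : ones_perp_basis V ->
  forall m (X : 'M[R]_(m, n)), X *m ones R n = 0 -> X *m V *m V^T = X.
Proof.
move=> [Ve VV] m X Xe.
case: n => [|n] in V Ve VV X Xe *; first by rewrite [X]thinmx0 !mul0mx.
have eqV : (V^T :=: kermx (ones R n.+1))%MS.
  apply/eqmxP; rewrite -mxrank_leqif_eq; last exact/sub_kermxP.
  have /eqP rV : row_free V^T by apply/row_freeP; exists V.
  rewrite rV mxrank_ker /= eqn_leq leq_subLR.
  have : (0 < \rank (ones R n.+1))%N.
    rewrite lt0n mxrank_eq0; apply/eqP => /matrixP/(_ 0 0).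
    by rewrite !mxE => /eqP; rewrite oner_eq0.
  by have := rank_leq_col (ones R n.+1); lia.
have /submxP[Y ->] : (X <= V^T)%MS by rewrite eqV; apply/sub_kermxP.
by rewrite -mulmxA -!mulmxA [V^T *m (V *m _)]mulmxA VV mul1mx.
Qed.

Lemma const_mxE n (gamma : R) :
  const_mx gamma = gamma *: (ones R n *m (ones R n)^T) :> 'M_n.
Proof.
by apply/matrixP => i j; rewrite !mxE big_ord1 !mxE !mulr1.
Qed.

(** The eigenvalues of the compressed Gram matrix are thus affine functions of
    those of the compressed adjacency matrix, with the same eigenvectors. *)
Lemma compress_dist_gram n (V : 'M[R]_(n, n.-1)) (G : rel 'I_n) alpha beta :
  orthonormal_cols V ->
  V^T *m dist_gram G alpha beta *m V =
    (beta / 2)%:M + ((beta - alpha) / 2) *: (V^T *m adjmx R G *m V).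
Proof.
move=> VV; rewrite /dist_gram mulmxDr mulmxDl mul_mx_scalar -scalemxAl VV.
by rewrite -scalemxAr -scalemxAl scalemx1.
Qed.

(** Factor the compression as [N = W *m W^T].  The rows of [V *m W] realize the
    distances, up to a translation: the position of the barycentre, encoded by
    the multiple of [z] added to every row of [V] below, is free.  Hypothesis
    [ones^T B V <= N] says that it can be chosen to give all the points the same
    norm, that is, to make the Gram matrix [dist_gram] plus a constant. *)
Lemma spherical_of_compression n (V : 'M[R]_(n, n.-1)) (G : rel 'I_n) r
    alpha beta (i0 j0 : 'I_n) :
  simple_graph G -> i0 != j0 -> ones_perp_basis V ->
  0 < alpha -> 0 < beta -> alpha != beta ->
  let B := dist_gram G alpha beta in
  let N := V^T *m B *m V in
  psd N -> (\rank N <= r)%N -> ((ones R n)^T *m B *m V <= N)%MS ->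
  has_spherical_representation R G r.
Proof.
move=> Gsimple ij0 Vb a0 b0 ab B N Npsd rN /submxP[z zN].
apply/(spherical_representationP r Gsimple ij0).
have BT : B^T = B by apply: dist_gram_sym; case: Gsimple.
have NT : N^T = N by rewrite /N !trmx_mul trmxK BT mulmxA.
have [W NW] := psd_factor NT Npsd rN.
have n0 : n%:R != 0 :> R by rewrite pnatr_eq0; case: (n) (i0) => [[]|].
pose e := ones R n.
have [Ve VV] := Vb.
have eV : e^T *m V = 0 by rewrite -[LHS]trmxK trmx_mul trmxK Ve trmx0.
have ee : e^T *m e = n%:R%:M.
  apply/matrixP => i j; rewrite !ord1 !mxE mulr1n.
  by under eq_bigr do rewrite !mxE mulr1; rewrite sumr_const card_ord.
(* S projects orthogonally onto the line of the all-ones vector *)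
pose S := n%:R^-1 *: (e *m e^T).
have ST : S^T = S by rewrite /S linearZ /= trmx_mul trmxK.
have VVT : V *m V^T = 1%:M - S.
  rewrite -[RHS](proj_ones_perp Vb).
    by rewrite mulmxBl mul1mx -scalemxAl -mulmxA eV mulmx0 scaler0 subr0.
  rewrite mulmxBl mul1mx -scalemxAl -mulmxA ee mul_mx_scalar scalerA mulVf //.
  by rewrite scale1r subrr.
pose T := n%:R^-1 *: (e *m z).
have TN : T *m N = S *m B *m V.
  by rewrite -!scalemxAl -(mulmxA e z) -zN !mulmxA.
have NT' : N *m T^T = V^T *m B *m S.
  by rewrite -{1}NT -trmx_mul TN !trmx_mul BT ST mulmxA.
have scalar_conj (q : 'M[R]_1) : e *m q *m e^T = q 0 0 *: (e *m e^T).
  by rewrite [q]mx11_scalar mul_mx_scalar -scalemxAl mxE eqxx mulr1n.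
have SBS : S *m B *m S = (n%:R^-1 ^+ 2 * (e^T *m B *m e) 0 0) *: (e *m e^T).
  rewrite -scalerA -scalar_conj /S -!scalemxAl -scalemxAr scalerA -expr2.
  by rewrite !mulmxA.
have TNT : T *m N *m T^T = (n%:R^-1 ^+ 2 * qform N z) *: (e *m e^T).
  rewrite -scalerA /qform -scalar_conj /T linearZ /= trmx_mul.
  by rewrite -!scalemxAl -scalemxAr scalerA -expr2 !mulmxA.
pose gamma := n%:R^-1 ^+ 2 * (qform N z - (e^T *m B *m e) 0 0).
exists alpha, beta, gamma, ((V + T) *m W); split=> //.
rewrite trmx_mul mulmxA -(mulmxA _ W) -NW -/B const_mxE.
rewrite linearD /= mulmxDr !mulmxDl TNT TN -(mulmxA V N T^T) NT'.
have -> : V *m N *m V^T = (1%:M - S) *m B *m (1%:M - S).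
  by rewrite /N -VVT !mulmxA.
have -> : S *m B *m V *m V^T = S *m B *m (1%:M - S) by rewrite -mulmxA VVT.
have -> : V *m (V^T *m B *m S) = (1%:M - S) *m B *m S by rewrite -VVT !mulmxA.
rewrite !mulmxBl !mulmxBr !mul1mx !mulmx1.
rewrite SBS /gamma mulrBr scalerBl.
by rewrite subrK -!addrA addKr [- _ + _]addrC.
Qed.

End GramMatrices.

(** * Complete multipartite graphs and the compressed spectrum *)

(** The parts are the classes of non-adjacency, which is reflexive and symmetric
    in a simple graph; only transitivity is at stake. *)
Lemma complete_multipartiteP n (G : rel 'I_n) : simple_graph G ->
  complete_multipartite G <->
  (forall i j k, ~~ G i j -> ~~ G j k -> ~~ G i k).
Proof.
move=> [Gs Gi]; split.
  move=> [P [Ppart indep adj]] i j k nij njk.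
  have covP x : exists2 B, B \in P & x \in B.
    exists (pblock P x);
      by rewrite ?pblock_mem ?mem_pblock ?(cover_partition Ppart).
  have [Bi PBi iBi] := covP i; have [Bj PBj jBj] := covP j.
  have [Bk PBk kBk] := covP k.
  have eij : Bi = Bj.
    by apply/eqP; apply: contraNT nij => ne; apply: (adj Bi Bj).
  have ejk : Bj = Bk.
    by apply/eqP; apply: contraNT njk => ne; apply: (adj Bj Bk).
  by apply: (indep Bi i k PBi iBi); rewrite eij ejk.
move=> tr; pose e := [rel i j | ~~ G i j].
have eqe : {in [set: 'I_n] & &, equivalence_rel e}.
  move=> i j k _ _ _ /=; split; first by rewrite Gi.
  move=> nij; apply/idP/idP => [|njk]; last exact: tr njk.
  by apply: tr; rewrite Gs.
have Ppart := equivalence_partitionP eqe.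
have tiP : trivIset (equivalence_partition e [set: 'I_n]) by case/and3P: Ppart.
exists (equivalence_partition e [set: 'I_n]); split=> //.
  move=> B i j PB iB jB.
  have := pblock_equivalence_partition eqe (in_setT i) (in_setT j).
  by rewrite (def_pblock tiP PB iB) jB /= => <-.
move=> B C i j PB PC neBC iB jC; apply/negPn/negP => nij.
have := pblock_equivalence_partition eqe (in_setT i) (in_setT j).
rewrite /= nij (def_pblock tiP PB iB) => jB.
by case/eqP: neBC; rewrite -(def_pblock tiP PB jB) (def_pblock tiP PC jC).
Qed.

Lemma nonadjacent_pair n (G : rel 'I_n) : irreflexive G ->
  ~ (G =2 @complete_graph n) -> exists i j, i != j /\ ~~ G i j.
Proof.
move=> Gi Gnc.
have [/existsP[i /existsP[j /andP[ij nij]]]|/existsPn H] :=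
  boolP [exists i, exists j, (i != j) && ~~ G i j]; first by exists i, j.
case: Gnc => i j; rewrite /complete_graph.
have [->|ij] := eqVneq i j; first by rewrite Gi.
by have /existsPn/(_ j) := H i; rewrite ij negbK.
Qed.

Section Spectrum.
Context {R : realType} (n : nat) (G : rel 'I_n) (V : 'M[R]_(n, n.-1)).
Hypotheses (G_simple : simple_graph G) (V_basis : ones_perp_basis V).

Local Notation A := (adjmx R G).
Local Notation M := (V^T *m A *m V).

Let Gs : symmetric G := proj1 G_simple.
Let Gi : irreflexive G := proj2 G_simple.
Let AT : A^T = A := adjmx_sym Gs.

Lemma compression_sym : M^T = M.
Proof. by rewrite !trmx_mul trmxK AT mulmxA. Qed.

Lemma qform_compression x : qform M x = qform A (x *m V^T).
Proof. by rewrite /qform trmx_mul trmxK !mulmxA. Qed.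

Lemma qform_ones_perp (x : 'rV[R]_n) : x *m ones R n = 0 ->
  qform M (x *m V) = qform A x /\ sqnorm (x *m V) = sqnorm x.
Proof.
move=> xe; have xVV := proj_ones_perp V_basis xe.
rewrite qform_compression xVV; split=> //.
by rewrite /sqnorm trmx_mul mulmxA xVV.
Qed.

Lemma delta_ones (i : 'I_n) : (delta_mx 0 i : 'rV_n) *m ones R n = 1%:M.
Proof. by rewrite -rowE row_const [LHS]mx11_scalar mxE. Qed.

(** The test vector with entries [1, 1, -2]: it detects induced paths and
    non-adjacent pairs with a common neighbour. *)
Lemma qform_path i j k : i != j -> i != k -> j != k ->
  let x := (delta_mx 0 i + delta_mx 0 j + (- 2) *: delta_mx 0 k) *m V in
  qform M x = 2 * (G i j)%:R - 4 * (G i k)%:R - 4 * (G j k)%:R /\ sqnorm x = 6.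
Proof.
move=> ij ik jk x.
have /qform_ones_perp[-> ->] :
  (delta_mx 0 i + delta_mx 0 j + (- 2) *: delta_mx 0 k : 'rV_n) *m ones R n = 0.
  rewrite !mulmxDl -scalemxAl !delta_ones.
  by rewrite -scalemx1; apply/matrixP => a b; rewrite !mxE; ring.
split; first by rewrite qform_delta3 // !mxE !Gi /= mulr0; ring.
rewrite /sqnorm -[X in X *m _]mulmx1 -/(qform _ _) qform_delta3 ?trmx1 // !mxE.
by rewrite !eqxx (negPf ij) (negPf ik) (negPf jk) !mulr0n !mulr1n; ring.
Qed.

(** If non-adjacency fails to be transitive at [i], [j], [k], the test vector
    with the weight [-2] at [j] has the positive value 2. *)
Lemma multipartite_of_nsd :
  (forall x, qform M x <= 0) -> complete_multipartite G.
Proof.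
move=> Mle; apply/(complete_multipartiteP G_simple) => i j k nij njk.
apply/negP => Gik.
have ik : i != k by apply: contraTneq Gik => ->; rewrite Gi.
have ij : i != j by apply: contraTneq Gik => ->.
have jk : k != j by apply: contraTneq Gik => ->.
have [E _] := qform_path ik ij jk.
have := Mle ((delta_mx 0 i + delta_mx 0 k + (- 2) *: delta_mx 0 j) *m V).
by rewrite E Gik (negPf nij) Gs (negPf njk) /=; lra.
Qed.

(** On vectors orthogonal to the all-ones vector, the form of [A] is minus the
    sum, over the parts, of the squared sum of the entries in the part. *)
Lemma nsd_of_multipartite : complete_multipartite G -> forall x, qform M x <= 0.
Proof.
move=> /(complete_multipartiteP G_simple) tr x.
(* f picks one vertex in each part, so that the complement of G, loops
   included, is the Gram matrix of the indicators of the parts *)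
pose f i := odflt i [pick j | ~~ G i j].
have fP i : ~~ G i (f i).
  by rewrite /f; case: pickP => [//|/(_ i)]; rewrite Gi.
have fE i j : (f i == f j) = ~~ G i j.
  apply/eqP/idP => [fij|nij].
    by apply: tr (fP i) _; rewrite fij Gs.
  rewrite /f; have -> : [pick k | ~~ G i k] = [pick k | ~~ G j k].
    apply: eq_pick => k; apply/idP/idP; last exact: tr.
    by apply: tr; rewrite Gs.
  by case: pickP => [//|/(_ j)]; rewrite Gi.
pose F : 'M[R]_n := \matrix_(i, k) (f i == k)%:R.
have AF : A = const_mx 1 - F *m F^T.
  apply/matrixP => i j; rewrite !mxE (bigD1 (f i)) //= big1 => [|k kfi].
    rewrite !mxE eqxx mul1r addr0 eq_sym fE.
    by case: (G i j); rewrite ?subr0 ?subrr.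
  by rewrite !mxE eq_sym (negPf kfi) mul0r.
rewrite qform_compression.
set y := x *m V^T.
have ye : y *m ones R n = 0.
  by rewrite -mulmxA; case: V_basis => -> _; rewrite mulmx0.
have -> : qform A y = - sqnorm (y *m F).
  rewrite -qform_gram AF const_mxE scale1r /qform mulmxBr mulmxA ye mul0mx.
  by rewrite sub0r mulNmx mxE.
by rewrite oppr_le0 sqnorm_ge0.
Qed.

(** In a complete multipartite graph, two non-adjacent vertices have the same
    neighbours, so the difference of their basis vectors lies in the kernel of
    [A]. *)
Lemma compression_eigenvalue0 : complete_multipartite G ->
  ~ (G =2 @complete_graph n) -> eigenvalue M 0.
Proof.
move=> /(complete_multipartiteP G_simple) tr Gnc.
have [i [j [ij nij]]] := nonadjacent_pair Gi Gnc.
pose x : 'rV[R]_n := delta_mx 0 i - delta_mx 0 j.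
have xe : x *m ones R n = 0 by rewrite mulmxBl !delta_ones subrr.
have xVV := proj_ones_perp V_basis xe.
have xA : x *m A = 0.
  rewrite mulmxBl -!rowE; apply/rowP => k; rewrite !mxE.
  suff -> : G i k = G j k by rewrite subrr.
  apply: negb_inj; apply/idP/idP; last exact: tr.
  by apply: tr; rewrite Gs.
apply/eigenvalueP; exists (x *m V).
  by rewrite !mulmxA xVV xA mul0mx scale0r.
apply/eqP => xV0; move: xVV; rewrite xV0 mul0mx => /rowP/(_ i).
by rewrite !mxE !eqxx (negPf ij) subr0 => /eqP; rewrite eq_sym oner_eq0.
Qed.

(** Two non-adjacent vertices and a common neighbour give the Rayleigh quotient
    [- 8 / 6]. *)
Lemma multipartite_min_eigenvalue mumin : complete_multipartite G ->
  ~ (G =2 @complete_graph n) -> ~ (G =2 @null_graph n) ->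
  min_eigenvalue M mumin -> mumin < -1.
Proof.
move=> /(complete_multipartiteP G_simple) tr Gnc Gnn [_ mu_le].
have [i [j [ij nij]]] := nonadjacent_pair Gi Gnc.
have [k Gik] : exists k, G i k.
  have [/existsP//|/existsPn H] := boolP [exists k, G i k].
  case: Gnn => a b; apply/negbTE; apply: tr (H b).
  by rewrite Gs; apply: H.
have Gjk : G j k by apply: contraTT Gik => /(tr _ _ _ nij).
have ik : i != k by apply: contraTneq Gik => ->; rewrite Gi.
have jk : j != k by apply: contraTneq Gjk => ->; rewrite Gi.
have [qE nE] := qform_path ij ik jk.
have := rayleigh_lower_bound compression_sym mu_le
  ((delta_mx 0 i + delta_mx 0 j + (- 2) *: delta_mx 0 k) *m V).
by rewrite qE nE Gik Gjk (negPf nij) /=; lra.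
Qed.

Lemma nsd_of_max_eigenvalue : max_eigenvalue M 0 -> forall x, qform M x <= 0.
Proof.
move=> [_ le_mu] x.
have MT : (- M)^T = - M by rewrite linearN /= compression_sym.
have := rayleigh_lower_bound MT (a := 0) _ x.
rewrite mul0r /qform mulmxN mulNmx [X in _ <= X]mxE oppr_ge0; apply=> b.
move=> /eigenvalueP[v vE v0]; rewrite -oppr_le0; apply: le_mu.
by apply/eigenvalueP; exists v; rewrite // scaleNr -vE mulmxN opprK.
Qed.

Lemma compression_rank mumin :
  \rank (M - mumin%:M) = (n - 1 - multiplicity M mumin)%N.
Proof.
rewrite /multiplicity /eigenspace mxrank_ker.
by rewrite subn1 subKn // rank_leq_row.
Qed.

(** Let [N] be the compression of the Gram matrix [Q *m Q^T] of a spherical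
    representation, centred at the origin, in dimension [r]; so [N] is positive
    semidefinite of rank at most [r].  If [r < n - 1] then [N] is singular, so
    [- (beta / (beta - alpha))] is an eigenvalue of [M]; it is at most 0 because
    [M] is negative semidefinite, and positivity of [N] leaves nothing of the
    spectrum of [M] below it.  It is therefore [mumin], [N] is a multiple of
    [M - mumin%:M], and its kernel annihilates [V^T *m Q], so that
    [B *m V *m U = 0], which is the equation for [A]. *)
Lemma spherical_dim_bound mumin r (i0 j0 : 'I_n) k (U : 'M[R]_(n.-1, k)) :
  i0 != j0 ->
  (forall x, qform M x <= 0) -> min_eigenvalue M mumin ->
  (U^T <= eigenspace M mumin)%MS ->
  has_spherical_representation R G r ->
  (n - 1 <= r)%N \/
  A *m (V *m U) = mumin *: (V *m U) /\ (n - 1 - multiplicity M mumin <= r)%N.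
Proof.
move=> ij0 Mle [mu_eig mu_le] Ueig.
move=> /(spherical_representationP r G_simple ij0).
move=> [alpha [beta [gamma [Q [a0 b0 ab QE]]]]].
pose B := dist_gram G alpha beta.
pose N := (beta / 2)%:M + ((beta - alpha) / 2) *: M.
have [Ve VV] := V_basis.
have VQ : V^T *m (Q *m Q^T) = V^T *m B.
  by rewrite QE mulmxDr const_mxE -scalemxAr mulmxA Ve mul0mx scaler0 addr0.
have NE : N = (V^T *m Q) *m (V^T *m Q)^T.
  by rewrite /N -compress_dist_gram // -VQ trmx_mul trmxK !mulmxA.
have rN : (\rank N <= r)%N.
  by rewrite NE (leq_trans (mxrankM_maxl _ _)) // rank_leq_col.
have Npsd : psd N by move=> x; rewrite NE qform_gram sqnorm_ge0.
have [|rlt] := leqP (n - 1) r; [by left | right].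
have ba0 : beta - alpha != 0 by rewrite subr_eq0 eq_sym.
have k0 : (beta - alpha) / 2 != 0 by rewrite mulf_neq0 // invr_eq0 pnatr_eq0.
have : kermx N != 0.
  by rewrite -mxrank_eq0 mxrank_ker; lia.
case/rowV0Pn => x /sub_kermxP xN x0.
have xsq : 0 < sqnorm x by rewrite lt_neqAle eq_sym sqnorm_eq0 x0 sqnorm_ge0.
have xq : (beta / 2) * sqnorm x + ((beta - alpha) / 2) * qform M x = 0.
  by rewrite -qform_affine -/N /qform xN mul0mx mxE.
have ba_pos : 0 < beta - alpha.
  rewrite lt_neqAle eq_sym ba0 /= leNgt; apply/negP => ba_neg.
  have := Mle x; nra.
have nu_ge : mumin <= - (beta / (beta - alpha)).
  apply: mu_le; apply/eigenvalueP; exists x => //.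
  apply: (scalerI k0).
  move: xN; rewrite mulmxDr mul_mx_scalar -scalemxAr => /eqP.
  rewrite addr_eq0 -scaleNr => /eqP; rewrite scalerA => xN.
  have -> : (beta - alpha) / 2 * - (beta / (beta - alpha)) = - (beta / 2).
    by field.
  by rewrite [RHS]scaleNr xN scaleNr opprK.
have mu_ge : 0 <= beta + (beta - alpha) * mumin.
  have /eigenvalueP[v vE v0] := mu_eig.
  have vsq : 0 < sqnorm v by rewrite lt_neqAle eq_sym sqnorm_eq0 v0 sqnorm_ge0.
  have := Npsd v; rewrite qform_affine.
  have -> : qform M v = mumin * sqnorm v by rewrite /qform vE -scalemxAl mxE.
  have -> : beta / 2 * sqnorm v + (beta - alpha) / 2 * (mumin * sqnorm v) =
    (beta + (beta - alpha) * mumin) / 2 * sqnorm v by ring.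
  by rewrite pmulr_lge0 // pmulr_lge0 ?invr_gt0 ?ltr0n.
have mu_eq : beta = - ((beta - alpha) * mumin).
  have : (beta - alpha) * mumin <= - beta.
    by rewrite mulrC -ler_pdivlMr // mulNr.
  lra.
have NM : N = ((beta - alpha) / 2) *: (M - mumin%:M).
  rewrite /N scalerBr addrC; congr (_ + _).
  by rewrite scale_scalar_mx -raddfN {1}mu_eq; congr (_%:M); ring.
split; last first.
  by rewrite -compression_rank; move: rN; rewrite NM mxrank_scale_nz.
have UN : U^T *m N = 0.
  by rewrite NM -scalemxAr (sub_kermxP Ueig) scaler0.
have UVB : U^T *m V^T *m B = 0.
  rewrite -mulmxA -VQ !mulmxA -(mulmxA U^T).
  by rewrite (mulmx_gram_eq0 (Y := V^T *m Q)) ?mul0mx // -NE.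
have BVU : B *m (V *m U) = 0.
  by have := congr1 trmx UVB; rewrite !trmx_mul !trmxK trmx0 dist_gram_sym.
apply: (scalerI k0).
move: BVU; rewrite /B /dist_gram mulmxDl mul_scalar_mx -scalemxAl => /eqP.
rewrite addrC addr_eq0 => /eqP ->; rewrite scalerA -scaleNr {1}mu_eq.
by congr (_ *: _); ring.
Qed.

(** With squared distances 2 on edges and 1 elsewhere, the compressed Gram matrix
    [(1 - M) / 2] is positive definite: the points form a simplex, and every
    simplex has a circumscribed sphere. *)
Lemma spherical_full_dim (i0 j0 : 'I_n) : i0 != j0 ->
  (forall x, qform M x <= 0) -> has_spherical_representation R G (n - 1).
Proof.
move=> ij0 Mle; have [_ VV] := V_basis.
have qE x : qform (V^T *m dist_gram G 2 1 *m V) x =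
    1 / 2 * sqnorm x - 1 / 2 * qform M x.
  by rewrite compress_dist_gram // qform_affine; field.
apply: (spherical_of_compression (alpha := 2) (beta := 1) G_simple ij0 V_basis).
- by [].
- by [].
- by rewrite (eqr_nat R 2 1).
- by move=> x; rewrite qE; have := Mle x; have := sqnorm_ge0 x; lra.
- by rewrite subn1 rank_leq_row.
apply: submx_full; rewrite row_full_unit -row_free_unit -kermx_eq0.
apply/rowV0P => x /sub_kermxP xN; apply/eqP; rewrite -sqnorm_eq0.
have := qE x; rewrite {1}/qform xN mul0mx mxE.
by have := Mle x; have := sqnorm_ge0 x; lra.
Qed.

(** Squared distances [- mumin - 1] on edges and [- mumin] elsewhere make the
    compressed Gram matrix [(M - mumin) / 2], whose kernel is the extremal
    eigenspace.  The condition for a common sphere is orthogonality to that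
    kernel, and [A Z = mumin Z] makes [dist_gram] itself vanish on it. *)
Lemma spherical_reduced_dim (i0 j0 : 'I_n) mumin k (U : 'M[R]_(n.-1, k)) :
  i0 != j0 -> mumin < -1 -> min_eigenvalue M mumin ->
  (eigenspace M mumin <= U^T)%MS -> A *m (V *m U) = mumin *: (V *m U) ->
  has_spherical_representation R G (n - 1 - multiplicity M mumin).
Proof.
move=> ij0 mu1 [_ mu_le] subU AVU; have [_ VV] := V_basis.
have MT : M^T = M := compression_sym.
pose alpha := - mumin - 1; pose beta := - mumin.
have NE : V^T *m dist_gram G alpha beta *m V = 2^-1 *: (M - mumin%:M).
  rewrite compress_dist_gram // scalerBr addrC; congr (_ + _).
    by congr (_ *: _); rewrite /alpha /beta; ring.
  by rewrite scale_scalar_mx -raddfN /beta; congr (_%:M); ring.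
apply: (spherical_of_compression (alpha := alpha) (beta := beta)
          G_simple ij0 V_basis).
- by rewrite /alpha; lra.
- by rewrite /beta; lra.
- by apply/eqP; rewrite /alpha /beta; lra.
- move=> x; rewrite compress_dist_gram // qform_affine /alpha /beta.
  by have := rayleigh_lower_bound MT mu_le x; lra.
- by rewrite NE mxrank_scale_nz ?compression_rank // invr_eq0 pnatr_eq0.
set N := V^T *m _ *m V in NE *; rewrite submxE; set K := cokermx N.
have NT : N^T = N by rewrite NE linearZ linearB /= MT tr_scalar_mx.
have /submxP[Y KE] : (K^T <= U^T)%MS.
  apply: submx_trans subU; apply/sub_kermxP.
  have : K^T *m N = 0 by rewrite -NT -trmx_mul mulmx_coker trmx0.
  rewrite NE -scalemxAr => /eqP; rewrite scaler_eq0 invr_eq0 pnatr_eq0 /=.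
  by move/eqP.
have -> : K = U *m Y^T by rewrite -[LHS]trmxK KE trmx_mul trmxK.
rewrite !mulmxA -!(mulmxA _ V) -!(mulmxA _ _ (V *m U)).
suff -> : dist_gram G alpha beta *m (V *m U) = 0 by rewrite mulmx0 mul0mx.
rewrite /dist_gram mulmxDl mul_scalar_mx -scalemxAl AVU scalerA -scalerDl.
rewrite [X in X *: _](_ : _ = 0) ?scale0r // /alpha /beta; ring.
Qed.

End Spectrum.

Theorem corollary5p2 (R : realType) (n : nat) (G : rel 'I_n)
    (G_simple : simple_graph G)
    (G_neq_complete : ~ (G =2 @complete_graph n))
    (G_neq_null : ~ (G =2 @null_graph n))
    (V : 'M[R]_(n, n.-1)) (V_basis : ones_perp_basis V)
    (mumin mumax : R)
    (mumin_eq : min_eigenvalue (V^T *m adjmx R G *m V) mumin)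
    (mumax_eq : max_eigenvalue (V^T *m adjmx R G *m V) mumax)
    (Uu : 'M[R]_(n.-1, multiplicity (V^T *m adjmx R G *m V) mumin))
    (Uu_basis : orthonormal_eigenbasis (V^T *m adjmx R G *m V) mumin Uu) :
  (complete_multipartite G <-> mumax = 0) /\
  (complete_multipartite G ->
   is_dimS R G
     (if adjmx R G *m (V *m Uu) == mumin *: (V *m Uu)
      then n - 1 - multiplicity (V^T *m adjmx R G *m V) mumin
      else n - 1)%N).
Proof.
split.
  split=> [Gcm | mu0].
    have := compression_eigenvalue0 G_simple V_basis Gcm G_neq_complete.
    case: mumax_eq => /eigenvalueP[v vE v0] le_mumax /le_mumax mumax_ge0.
    apply/eqP; rewrite eq_le mumax_ge0 andbT leNgt; apply/negP => mu_pos.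
    have := nsd_of_multipartite G_simple V_basis Gcm v.
    rewrite /qform vE -scalemxAl mxE leNgt pmulr_rgt0 //.
    by rewrite lt_neqAle eq_sym sqnorm_eq0 v0 sqnorm_ge0.
  apply: (multipartite_of_nsd G_simple V_basis).
  by apply: nsd_of_max_eigenvalue; rewrite -?mu0.
move=> Gcm.
have Mle := nsd_of_multipartite G_simple V_basis Gcm.
have mu1 := multipartite_min_eigenvalue G_simple V_basis Gcm G_neq_complete
              G_neq_null mumin_eq.
have [i0 [j0 ij0]] : exists i j : 'I_n, i != j.
  have [/existsP[i /existsP[j ij]]|/existsPn H] :=
    boolP [exists i : 'I_n, exists j, i != j]; first by exists i, j.
  case: G_neq_null => i j; have /existsPn/(_ j)/negPn/eqP-> := H i.
  by case: G_simple => _ ->.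
have [_ UE] := Uu_basis; rewrite (compression_sym V G_simple) in UE.
have Ueig : (Uu^T <= eigenspace (V^T *m adjmx R G *m V) mumin)%MS by rewrite UE.
have eigU : (eigenspace (V^T *m adjmx R G *m V) mumin <= Uu^T)%MS by rewrite UE.
have lower s :=
  spherical_dim_bound G_simple V_basis ij0 Mle mumin_eq Ueig (r := s).
case: eqP => AVU; split.
- exact: (spherical_reduced_dim G_simple V_basis ij0 mu1 mumin_eq eigU AVU).
- by move=> s /lower[|[_ //]]; apply: leq_trans; rewrite leq_subr.
- exact: (spherical_full_dim G_simple V_basis ij0 Mle).
- by move=> s /lower[//|[]].
Qed.
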